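(* A parallel truncation of the regular triangle increases the deviation rate, while a non-parallel truncation decreases it. Precisely, let $T=T(\alpha,\beta,\gamma)$ be a regular triangle in $\mathbb{C}$ with vertices $\alpha,\beta,\gamma$ in counterclockwise order, let $\lambda>0$, and for small $t>0$ let $V_t=T(\beta_t,\beta,\gamma,\gamma_t)$ be the quadrangle with $$\beta_t=(1-t)\alpha+t\beta,\qquad \gamma_t=(1-\lambda t)\alpha+\lambda t\gamma .$$ If $\lambda=1$ (parallel truncation), then $\delta(X_{V_t})>\delta(X_T)$ for all sufficiently small $t>0$. If $\lambda\neq1$ (non-parallel truncation), then $\delta(X_{V_t})<\delta(X_T)$ for all sufficiently small $t>0$ (depending on $\lambda$).
   Context: $\Omega=\mathbb{R}/2\pi\mathbb{Z}$ carries the normalized Lebesgue (uniform probability) measure, with expectation $\mathbb{E}$. $T(\alpha_1,\dots,\alpha_n)$ denotes the convex polygon with vertices $\alpha_1,\dots,\alpha_n\in\mathbb{C}$ in counterclockwise order ($\alpha_{n+1}=\alpha_1$), and $X_T(\omega)=\sum_{j=1}^n|\alpha_{j+1}-\alpha_j|\max\{\sin(\arg(\alpha_{j+1}-\alpha_j)-\omega),0\}$ is the length of the orthogonal shadow of $T$ under light from direction $\omega$ (the width of $T$ along $\omega+\frac{\pi}{2}$). The deviation rate is $\delta(X_T)=\sqrt{\mathbb{E}(X_T^2)-\mathbb{E}(X_T)^2}/\mathbb{E}(X_T)$. A truncation of the regular triangle is a quadrangle obtained by cutting off a vertex by a line near it; it is called parallel if the line is parallel to the side opposite to the vertex, and non-parallel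 otherwise. *)

(* Defs.v *)
From HB Require Import structures.
From mathcomp Require Import all_boot all_order all_algebra.
From mathcomp Require Import complex.
From mathcomp Require Import all_classical all_reals all_analysis.

Set Implicit Arguments.
Unset Strict Implicit.
Unset Printing Implicit Defensive.

Import Order.TTheory GRing.Theory Num.Theory.
Import numFieldNormedType.Exports.

Local Open Scope classical_set_scope.
Local Open Scope ring_scope.
Local Open Scope complex_scope.

Lemma two_pi_gt0 (R : realType) : 0 < 2 * pi :> R.
Proof. by rewrite mulr_gt0// pi_gt0. Qed.

(* The circle R/2piZ with its normalized Lebesgue measure is represented by the
   uniform probability on the fundamental domain [0, 2pi]; the double endpoint
   is negligible. *)
Definition circle_prob (R : realType) :
    probability (measurableTypeR R) R :=
  uniform_prob (two_pi_gt0 R).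

(* Principal argument, with values in ]-pi, pi]. At 0 it takes a junk value. *)
Definition carg (R : realType) (z : R[i]) : R :=
  let a := acos (complex.Re z / ComplexField.Normc.normc z) in
  if 0 <= complex.Im z then a else - a.

(* [ordS] is the cyclic successor, so the edge after the last vertex returns to
   the first one. *)
Definition shadow (R : realType) (n : nat) (v : n.-tuple R[i]) (w : R) : R :=
  \sum_(j < n)
    let e := tnth v (ordS j) - tnth v j in
    ComplexField.Normc.normc e * Num.max (sin (carg e - w)) 0.

Definition circle_mean (R : realType) (X : R -> R) : R :=
  fine (expectation (circle_prob R) X).

Definition deviation_rate (R : realType) (X : R -> R) : R :=
  Num.sqrt (circle_mean (fun w => X w ^+ 2) - circle_mean X ^+ 2)
  / circle_mean X.

(* The sign condition says that c lies strictly to the left of the oriented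
   line from a to b; it also excludes the degenerate case a = b = c. *)
Definition ccw_regular_triangle (R : realType) (a b c : R[i]) : Prop :=
  [/\ ComplexField.Normc.normc (b - a) = ComplexField.Normc.normc (c - b),
      ComplexField.Normc.normc (c - b) = ComplexField.Normc.normc (a - c)
    & 0 < complex.Im (conjc (b - a) * (c - a))].

(* The two points that the cut puts on the sides from a to b and from a to c
   are at parameters t and l * t. *)
Definition truncation (R : realType) (a b c : R[i]) (l t : R) :
    4.-tuple R[i] :=
  [tuple (1 - t)%:C * a + t%:C * b; b; c;
         (1 - l * t)%:C * a + (l * t)%:C * c].

(* Main.v *)
Require Import Defs.
From HB Require Import structures.
From mathcomp Require Import all_boot all_order all_algebra.
From mathcomp Require Import complex.
From mathcomp Require Import all_classical all_reals all_analysis.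
From mathcomp Require Import measurable_realfun ring lra.

Set Implicit Arguments.
Unset Strict Implicit.
Unset Printing Implicit Defensive.

Import Order.TTheory GRing.Theory Num.Theory.
Import numFieldNormedType.Exports.

Local Open Scope classical_set_scope.
Local Open Scope ring_scope.
Local Open Scope complex_scope.

(** Only the ratio of the second moment of the shadow to the square of its mean
    matters, and it has a closed form. Let [h_th w = max (sin (th - w)) 0] be the
    shadow of a unit edge of direction [th]. The shadow of a polygon is the sum
    of its [L_j * h_th_j], so its mean is the perimeter divided by [pi], and its
    second moment is a quadratic form in the edge lengths, whose coefficients
    [half_sine_dot] depend only on the angle [phi] between the two edges and
    equal [corr phi = ((pi - phi) cos phi + sin phi) / 2] ([half_sine_dotE]; this
    needs the rotation invariance [Rintegral_period_shift]). With
    [energy] for this quadratic form, the deviation rate is an increasing function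
    of [energy / perimeter ^ 2] ([deviation_rate_fan_lt]).

    The truncation [V_t] has edges of the three directions of the triangle, of
    lengths [1 - t], [1], [1 - l t] for a unit side, and a new edge of length
    [t d] ([shadow_truncation]). Hence
    [energy V_t * perimeter V_0 ^ 2 - energy V_0 * perimeter V_t ^ 2] is a
    polynomial in [t] without constant term, and it equals
    [t * (18 d (S - q) + t e)]. Here [S] is the inner product of the shadow of the
    triangle with the half-sine of the cut, and [q] its inner product with the
    half-sine of a side. As a function of the direction, that inner product is
    largest exactly at the directions of the sides
    ([cross_energy_lt], [corr_sum_lt]), by the convexity of [tan].

    - If the cut is not parallel to the opposite side, its direction is not that
      of any side, so [S < q] and the first order term makes the deviation rate
      decrease.
    - If it is parallel, [S = q], the first order term vanishes, and the sign is
      that of [e = 5 pi - 6 sqrt 3], which is positive as [pi > 3]. *)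

(** * Integrals of continuous functions and periodicity *)

Section Integrals.
Context {R : realType}.
Implicit Types (f g F : R -> R) (a b c s x T : R).

Local Notation mu := (@lebesgue_measure R).

Lemma continuous_integrable_segment f a b :
  continuous f -> mu.-integrable `[a, b] (EFin \o f).
Proof.
move=> cf; apply: continuous_compact_integrable; first exact: segment_compact.
exact: continuous_subspaceT.
Qed.

(** A form of the fundamental theorem that asks for a derivative on the closed
    interval, so that all the continuity side conditions come for free; it also
    covers the degenerate interval. *)
Lemma Rintegral_FTC2 f F a b : a <= b -> continuous f ->
  (forall x, a <= x <= b -> is_derive x 1 F (f x)) ->
  \int[mu]_(x in `[a, b]) f x = F b - F a.
Proof.
rewrite le_eqVlt => /predU1P[<- _ _|ab cf dF].
  by rewrite set_itv1 Rintegral_set1 subrr.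
have cF x : a <= x <= b -> {for x, continuous F}.
  move=> /dF dFx.
  by apply/differentiable_continuous/derivable1_diffP.
rewrite /Rintegral (@continuous_FTC2 _ f F)//.
- exact: continuous_subspaceT.
- split=> [x||].
  + by rewrite in_itv/= => /andP[ax xb]; have := dF x; rewrite !ltW// => -[].
  + by apply: cvg_at_right_filter; apply: cF; rewrite lexx ltW.
  + by apply: cvg_at_left_filter; apply: cF; rewrite lexx ltW.
- move=> x; rewrite in_itv/= => /andP[ax xb].
  by rewrite derive1E; apply: derive_val; apply: dF; rewrite !ltW.
Qed.

(** A bounded window is enough for the uses below, and starting the integral at
    its left end avoids the case distinction on the sign of [x] that a global
    antiderivative would need. *)
Lemma continuous_antiderivative f a b : continuous f ->
  exists F, forall x, a < x < b -> is_derive x 1 F (f x).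
Proof.
move=> cf; exists (fun x => \int[mu]_(t in `[a, x]) f t) => x /andP[ax xb].
have [dF F'x] := continuous_FTC1_closed xb
  (continuous_integrable_segment a b cf) ax (cf x).
by split; [exact: dF|rewrite -derive1E; exact: F'x].
Qed.

Lemma Rintegral_chasles f a b c : a <= b -> b <= c -> continuous f ->
  \int[mu]_(x in `[a, c]) f x =
  \int[mu]_(x in `[a, b]) f x + \int[mu]_(x in `[b, c]) f x.
Proof.
move=> ab bc cf; have ac := le_trans ab bc.
have [F dF] := continuous_antiderivative (a - 1) (c + 1) cf.
have IF u v : a <= u -> u <= v -> v <= c ->
    \int[mu]_(x in `[u, v]) f x = F v - F u.
  move=> ? ? ?; apply: Rintegral_FTC2 => // x /andP[? ?].
  by apply: dF; apply/andP; split; lra.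
by rewrite !IF//; ring.
Qed.

Lemma is_derive1M f g x (a b : R) : is_derive x 1 f a -> is_derive x 1 g b ->
  is_derive x 1 (fun y => f y * g y) (a * g x + f x * b).
Proof.
move=> df dg; apply: (is_derive_eq (is_deriveM df dg)).
by rewrite /GRing.scale/=; ring.
Qed.

Lemma is_derive1D f g x (a b : R) : is_derive x 1 f a -> is_derive x 1 g b ->
  is_derive x 1 (fun y => f y + g y) (a + b).
Proof. exact: is_deriveD. Qed.

Lemma is_derive1B f g x (a b : R) : is_derive x 1 f a -> is_derive x 1 g b ->
  is_derive x 1 (fun y => f y - g y) (a - b).
Proof. exact: is_deriveB. Qed.

Lemma is_derive1Ml f c x (a : R) : is_derive x 1 f a ->
  is_derive x 1 (fun y => c * f y) (c * a).
Proof.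
move=> df; apply: (is_derive_eq (is_derive1M (is_derive_cst c x 1) df)).
by rewrite mul0r add0r.
Qed.

Lemma is_derive_translate F s x (d : R) :
  is_derive (x + s) 1 F d -> is_derive x 1 (fun y => F (y + s)) d.
Proof.
move=> dF; have ds : is_derive x (1 : R) (shift s) 1 by exact: is_derive_shift.
by have := @is_derive1_comp _ F _ x _ _ dF ds; rewrite mulr1.
Qed.

(** With [F] an antiderivative of [f], both integrals are increments of [F], and
    [F (u + T) - F u] does not depend on [u], because its derivative
    [f (u + T) - f u] vanishes. *)
Lemma Rintegral_period_shift f s T : 0 <= T -> continuous f ->
  (forall x, f (x + T) = f x) ->
  \int[mu]_(x in `[0, T]) f (x + s) = \int[mu]_(x in `[0, T]) f x.
Proof.
move=> T0 cf fT.
(* The window on which [F] is needed must contain [0], [s], [T] and [s + T]. *)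
have ns : - `|s| <= s <= `|s| by rewrite -ler_norml.
have [F dF] := continuous_antiderivative (- `|s| - 1) (`|s| + T + 1) cf.
have dFs (u x : R) : - `|s| <= u <= `|s| -> 0 <= x <= T ->
    is_derive x 1 (fun y => F (y + u)) (f (x + u)).
  move=> /andP[? ?] /andP[? ?].
  by apply: is_derive_translate; apply: dF; apply/andP; split; lra.
have cfs : continuous (fun x => f (x + s)).
  move=> x; apply: continuous_comp; last exact: cf.
  by apply: cvgD; [exact: cvg_id|exact: cvg_cst].
transitivity (F (T + s) - F (0 + s)).
  by apply: (@Rintegral_FTC2 _ (fun x => F (x + s))) => // x; exact: dFs.
transitivity (F T - F 0); last first.
  apply/esym/Rintegral_FTC2 => // x /andP[? ?].
  by apply: dF; apply/andP; split; lra.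
have dG (u : R) : - `|s| <= u <= `|s| ->
    is_derive u 1 (fun y => F (y + T) - F y) 0.
  move=> us; have [? ?] := andP us.
  rewrite -(subrr (f u)) -{1}fT; apply: is_deriveB; last first.
    by apply: dF; apply/andP; split; lra.
  by apply: is_derive_translate; apply: dF; apply/andP; split; lra.
have cG (u : R) : - `|s| <= u <= `|s| ->
    {for u, continuous (fun y => F (y + T) - F y)}.
  by move=> /dG dGu; apply/differentiable_continuous/derivable1_diffP.
have G_eq (u v : R) : - `|s| <= u -> u <= v -> v <= `|s| ->
    F (u + T) - F u = F (v + T) - F v.
  move=> su uv vs.
  have [x||x _] := @MVT_segment _ (fun y => F (y + T) - F y) (cst 0) _ _ uv.
  - by rewrite in_itv/= => /andP[? ?]; apply: dG; apply/andP; split; lra.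
  - apply: continuous_in_subspaceT => y /[!inE]/=.
    by rewrite in_itv/= => /andP[? ?]; apply: cG; apply/andP; split; lra.
  - by rewrite mul0r => /eqP; rewrite subr_eq0 => /eqP ->.
have [n1 n2] := andP ns; rewrite (addrC T).
have [s0|/ltW s0] := leP 0 s.
  by have := G_eq 0 s _ s0 n2; rewrite !add0r => ->//; rewrite oppr_le0.
by have := G_eq s 0 n1 s0 _; rewrite !add0r => ->.
Qed.

End Integrals.

(** * Inner products of half-sines *)

Section HalfSine.
Context {R : realType}.
Implicit Types (w s phi th : R).

Local Notation mu := (@lebesgue_measure R).
Local Notation circle := `[0%R, (2 * pi)%R]%classic.

(** The positive part keeps only the edges on one side of the polygon, so that no
    part of the shadow is counted twice. *)
Definition half_sine th w : R := Num.max (sin (th - w)) 0.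

Lemma half_sine_ge0 th w : 0 <= half_sine th w.
Proof. by rewrite /half_sine le_max lexx orbT. Qed.

Lemma continuous_half_sine th : continuous (half_sine th).
Proof.
move=> w; apply: continuous_max; last exact: cvg_cst.
apply: continuous_comp; last exact: continuous_sin.
by apply: cvgB; [exact: cvg_cst|exact: cvg_id].
Qed.

Lemma continuous_half_sineM th th' :
  continuous (fun w => half_sine th w * half_sine th' w).
Proof. by move=> w; apply: cvgM; exact: continuous_half_sine. Qed.

Lemma half_sineDD th w s : half_sine (th + s) (w + s) = half_sine th w.
Proof. by rewrite /half_sine (_ : th + s - (w + s) = th - w)//; ring. Qed.

Lemma half_sineD2pi th : half_sine (th + 2 * pi) = half_sine th.
Proof.
apply/funext => w; rewrite /half_sine (_ : _ - w = th - w + pi *+ 2).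
  by rewrite sinD2pi.
by rewrite -[pi *+ 2 in RHS]mulr_natl; ring.
Qed.

Lemma half_sine_periodic th w : half_sine th (w + 2 * pi) = half_sine th w.
Proof. by rewrite -[in LHS](half_sineD2pi th) half_sineDD. Qed.

Lemma half_sine_pi w : half_sine pi w = Num.max (sin w) 0.
Proof. by rewrite /half_sine sinB sinpi cospi mul0r sub0r mulN1r opprK. Qed.

Lemma sin_le0_pi_2pi w : pi <= w <= 2 * pi -> sin w <= 0.
Proof.
move=> /andP[w1 w2]; rewrite -[w](subrK pi) sinDpi oppr_le0.
by apply: sin_ge0_pi; apply/andP; split; lra.
Qed.

(** By rotation invariance the edge may be turned to direction [pi], for which
    the positive half-wave is exactly the first half of the window
    [[0, 2 pi]]. *)
Lemma Rintegral_half_sine th : \int[mu]_(w in circle) half_sine th w = 2.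
Proof.
have pi0 := @pi_gt0 R.
transitivity (\int[mu]_(w in circle) half_sine pi w).
  rewrite -(@Rintegral_period_shift _ (half_sine pi) (pi - th)).
  - by apply: eq_Rintegral => w _; rewrite -(half_sineDD th _ (pi - th)) subrKC.
  - by rewrite mulr_ge0// ltW.
  - exact: continuous_half_sine.
  - exact: half_sine_periodic.
rewrite (@Rintegral_chasles _ _ _ pi); [|lra|lra|exact: continuous_half_sine].
rewrite [X in X + _](_ : _ = \int[mu]_(w in `[0, pi]) sin w); last first.
  apply: eq_Rintegral => w /[!inE]/=; rewrite in_itv/= => wpi.
  by rewrite half_sine_pi max_l// sin_ge0_pi.
rewrite [X in _ + X](_ : _ = \int[mu]_(w in `[pi, 2 * pi]) 0); last first.
  apply: eq_Rintegral => w /[!inE]/=; rewrite in_itv/= => wpi.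
  by rewrite half_sine_pi max_r// sin_le0_pi_2pi.
rewrite Rintegral_cst//= mul0r addr0.
apply: (etrans (@Rintegral_FTC2 _ sin (fun w => - cos w) _ _ _ _ _)); last first.
- by rewrite cospi cos0; ring.
- by move=> w _; apply: is_derive_eq; rewrite opprK.
- exact: continuous_sin.
- exact: pi_ge0.
Qed.

Definition half_sine_dot th th' : R :=
  \int[mu]_(w in circle) (half_sine th w * half_sine th' w).

Lemma half_sine_dotC th th' : half_sine_dot th th' = half_sine_dot th' th.
Proof. by apply: eq_Rintegral => w _; rewrite mulrC. Qed.

Lemma half_sine_dotD2pi th th' :
  half_sine_dot (th + 2 * pi) th' = half_sine_dot th th'.
Proof. by rewrite /half_sine_dot half_sineD2pi. Qed.

Lemma half_sine_dotDD th th' s :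
  half_sine_dot (th + s) (th' + s) = half_sine_dot th th'.
Proof.
rewrite /half_sine_dot.
rewrite -(@Rintegral_period_shift _ _ s).
- by apply: eq_Rintegral => w _; rewrite !half_sineDD.
- by rewrite mulr_ge0// pi_ge0.
- exact: continuous_half_sineM.
- by move=> w; rewrite !half_sine_periodic.
Qed.

(** The inner product in L^2 of two half-sines whose directions differ by an
    angle [phi] of [[0, pi]]. *)
Definition corr phi : R := ((pi - phi) * cos phi + sin phi) / 2.

(** Turning the two edges to the directions [pi] and [pi - phi] makes their
    half-waves overlap on the initial interval [[0, pi - phi]], where the product
    is the smooth function [sin w * sin (w + phi)]; elsewhere one factor
    vanishes. *)
Lemma half_sine_dotE th phi : 0 <= phi <= pi ->
  half_sine_dot (th + phi) th = corr phi.
Proof.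
move=> /andP[phi0 phipi]; have pi0 := @pi_gt0 R.
rewrite -(half_sine_dotDD _ _ (pi - phi - th)).
rewrite (_ : th + phi + (pi - phi - th) = pi); last by ring.
rewrite (_ : th + (pi - phi - th) = pi - phi); last by ring.
have hE w : half_sine (pi - phi) w = Num.max (sin (w + phi)) 0.
  rewrite /half_sine (_ : pi - phi - w = pi - (w + phi)); last by ring.
  by rewrite sinB sinpi cospi mul0r sub0r mulN1r opprK.
rewrite /half_sine_dot (@Rintegral_chasles _ _ _ (pi - phi)); last first.
- exact: continuous_half_sineM.
- lra.
- lra.
rewrite [X in X + _](_ : _ =
    \int[mu]_(w in `[0, pi - phi]) (sin w * sin (w + phi))); last first.
  apply: eq_Rintegral => w /[!inE]/=; rewrite in_itv/= => /andP[w0 w1].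
  rewrite half_sine_pi hE !max_l// sin_ge0_pi//; apply/andP; split; lra.
rewrite [X in _ + X](_ : _ = \int[mu]_(w in `[pi - phi, 2 * pi]) 0); last first.
  apply: eq_Rintegral => w /[!inE]/=; rewrite in_itv/= => /andP[w0 w1].
  rewrite half_sine_pi hE.
  have [wpi|piw] := leP w pi.
    rewrite (max_r (x := sin (w + phi))) ?mulr0// sin_le0_pi_2pi//.
    by apply/andP; split; lra.
  by rewrite max_r ?mul0r// sin_le0_pi_2pi// ltW.
rewrite Rintegral_cst//= mul0r addr0.
pose F w : R := 2^-1 * (cos phi * w - sin w * cos (w + phi)).
apply: (etrans (@Rintegral_FTC2 _ _ F _ _ _ _ _)).
- lra.
- move=> w; apply: cvgM; first exact: continuous_sin.
  apply: continuous_comp; last exact: continuous_sin.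
  by apply: cvgD; [exact: cvg_id|exact: cvg_cst].
- move=> w _.
  have d1 : is_derive w 1 (fun y => cos (y + phi)) (- sin (w + phi)).
    exact: is_derive_translate.
  have := is_derive1Ml 2^-1 (is_derive1B
    (is_derive1Ml (cos phi) (is_derive_id w 1))
    (is_derive1M (is_derive_sin w) d1)).
  move=> dF; apply: (is_derive_eq dF).
  rewrite (_ : cos phi = cos (w + phi - w)); last by congr cos; ring.
  by rewrite cosB; field.
- by rewrite /F subrK cospi sin0 sinB sinpi cospi /corr; field.
Qed.

End HalfSine.

(** * Moments of a sum of half-sines *)

Section Fan.
Context {R : realType}.
Implicit Types (s : seq (R * R)) (w : R) (X : R -> R).

Local Notation mu := (@lebesgue_measure R).
Local Notation circle := `[0%R, (2 * pi)%R]%classic.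

Lemma circle_meanE X : continuous X -> (forall w, 0 <= X w) ->
  circle_mean X = (2 * pi)^-1 * \int[mu]_(w in circle) X w.
Proof.
move=> cX X0; rewrite /circle_mean unlock /circle_prob integral_uniform//.
- rewrite subr0 fineM//; apply: integrable_fin_num => //.
  exact: continuous_integrable_segment.
- by apply/measurable_EFinP; exact: continuous_measurable_fun.
Qed.

Lemma continuous_lincomb (I : Type) (s : seq I) (c : I -> R) (f : I -> R -> R) :
  (forall i, continuous (f i)) -> continuous (fun x => \sum_(i <- s) c i * f i x).
Proof.
move=> cf; elim: s => [|i s IHs].
  rewrite (_ : (fun _ => _) = cst 0); first exact: cst_continuous.
  by apply/funext => x; rewrite big_nil.
rewrite (_ : (fun _ => _) = fun x => c i * f i x + \sum_(j <- s) c j * f j x).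
  move=> x; apply: cvgD; last exact: IHs.
  by apply: cvgM; [exact: cvg_cst|exact: cf].
by apply/funext => x; rewrite big_cons.
Qed.

Lemma Rintegral_lincomb (I : Type) (s : seq I) (c : I -> R) (f : I -> R -> R)
    (a b : R) : (forall i, continuous (f i)) ->
  \int[mu]_(x in `[a, b]) (\sum_(i <- s) c i * f i x) =
  \sum_(i <- s) c i * \int[mu]_(x in `[a, b]) f i x.
Proof.
move=> cf; elim: s => [|i s IHs].
  rewrite big_nil (_ : (fun _ => _) = cst 0).
    by rewrite Rintegral_cst//= mul0r.
  by apply/funext => x; rewrite big_nil.
rewrite big_cons -IHs -RintegralZl//; last exact: continuous_integrable_segment.
rewrite -RintegralD//.
- by apply: eq_Rintegral => x _; rewrite big_cons.
- apply: continuous_integrable_segment => x.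
  by apply: cvgM; [exact: cvg_cst|exact: cf].
- by apply: continuous_integrable_segment; exact: continuous_lincomb.
Qed.

(** The shadow of a polygon is determined by the list of the lengths and
    directions of its edges. Working with such lists, rather than with vertices,
    makes both moments polynomial in the lengths. *)
Definition fan s w : R := \sum_(p <- s) p.1 * half_sine p.2 w.

Definition perimeter s : R := \sum_(p <- s) p.1.

Definition energy s : R :=
  \sum_(p <- s) p.1 * \sum_(q <- s) q.1 * half_sine_dot p.2 q.2.

Lemma continuous_fan s : continuous (fan s).
Proof. by apply: continuous_lincomb => p; exact: continuous_half_sine. Qed.

Lemma continuous_fan2 s : continuous (fun w => fan s w ^+ 2).
Proof. by move=> w; apply: cvgM; exact: continuous_fan. Qed.

Lemma Rintegral_fan s : \int[mu]_(w in circle) fan s w = 2 * perimeter s.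
Proof.
rewrite Rintegral_lincomb; last by move=> p; exact: continuous_half_sine.
rewrite mulr_sumr; apply: eq_bigr => p _.
by rewrite Rintegral_half_sine mulrC.
Qed.

Lemma Rintegral_fan2 s : \int[mu]_(w in circle) fan s w ^+ 2 = energy s.
Proof.
transitivity (\int[mu]_(w in circle) \sum_(p <- s) p.1 *
    (\sum_(q <- s) q.1 * (half_sine p.2 w * half_sine q.2 w))).
  apply: eq_Rintegral => w _; rewrite expr2 {1}/fan mulr_suml.
  apply: eq_bigr => p _; rewrite -mulrA; congr (_ * _).
  by rewrite mulr_sumr; apply: eq_bigr => q _; rewrite mulrCA.
rewrite Rintegral_lincomb; last first.
  by move=> p; apply: continuous_lincomb => q; exact: continuous_half_sineM.
apply: eq_bigr => p _; congr (_ * _); rewrite Rintegral_lincomb//.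
by move=> q; exact: continuous_half_sineM.
Qed.

(** This is the Cauchy-Schwarz inequality between the shadow and the constant 1,
    in other words the nonnegativity of the variance; it is obtained by
    integrating the square of the centred shadow. *)
Lemma perimeter_energy s : 2 * perimeter s ^+ 2 <= pi * energy s.
Proof.
have pi0 := @pi_gt0 R.
(* [m] is the mean of the shadow. *)
pose m := perimeter s / pi.
have : 0 <= \int[mu]_(w in circle) (fan s w - m) ^+ 2.
  by apply: Rintegral_ge0 => w _; exact: sqr_ge0.
rewrite (_ : \int[mu]_(w in circle) (fan s w - m) ^+ 2 =
    \int[mu]_(w in circle) (fan s w ^+ 2 + (- (2 * m) * fan s w + m ^+ 2)));
  last by apply: eq_Rintegral => w _; ring.
have i1 := continuous_integrable_segment 0 (2 * pi) (@continuous_fan2 s).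
have i2 := continuous_integrable_segment 0 (2 * pi) (@continuous_fan s).
have i3 := continuous_integrable_segment 0 (2 * pi)
  (@cst_continuous R R (m ^+ 2)).
have c4 : continuous (fun w => - (2 * m) * fan s w).
  by move=> w; apply: cvgM; [exact: cvg_cst|exact: continuous_fan].
have i4 := continuous_integrable_segment 0 (2 * pi) c4.
have c5 : continuous (fun w => - (2 * m) * fan s w + m ^+ 2).
  by move=> w; apply: cvgD; [exact: c4|exact: cvg_cst].
have i5 := continuous_integrable_segment 0 (2 * pi) c5.
rewrite RintegralD// RintegralD// RintegralZl// Rintegral_fan2 Rintegral_fan.
rewrite Rintegral_cst//= lebesgue_measure_itv/= lte_fin mulr_gt0//=.
rewrite -(pmulr_rge0 _ pi0) oppr0 addr0 => h.
rewrite -subr_ge0 [leRHS](_ : _ = pi * (energy s +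
  (- (2 * m) * (2 * perimeter s) + m ^+ 2 * (2 * pi))))//.
by rewrite /m; move: pi (gt_eqF pi0) => c c0; field; rewrite c0.
Qed.

(** The mean of the shadow is [perimeter s / pi] (Cauchy's formula) and its second
    moment is [energy s / (2 * pi)]. *)
Lemma deviation_rate_fan s : (forall p, p \in s -> 0 <= p.1) -> 0 < perimeter s ->
  deviation_rate (fan s) =
  Num.sqrt (pi * energy s / (2 * perimeter s ^+ 2) - 1).
Proof.
move=> s0 ws; have pi0 := @pi_gt0 R.
have f0 w : 0 <= fan s w.
  rewrite /fan big_seq; apply: sumr_ge0 => p ps.
  by rewrite mulr_ge0 ?s0 ?half_sine_ge0.
rewrite /deviation_rate (circle_meanE (@continuous_fan s) f0).
rewrite (circle_meanE (@continuous_fan2 s)); last by move=> w; exact: sqr_ge0.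
rewrite Rintegral_fan2 Rintegral_fan.
have -> : (2 * pi)^-1 * (2 * perimeter s) = perimeter s / pi.
  by move: pi (gt_eqF pi0) => c c0; field; rewrite c0.
have m0 : 0 < perimeter s / pi by rewrite divr_gt0.
rewrite -[X in _ / X](ger0_norm (ltW m0)) -sqrtr_sqr -sqrtrV ?sqr_ge0//.
rewrite -sqrtrM; last first.
  rewrite subr_ge0 expr_div_n ler_pdivrMr ?exprn_gt0//.
  have := perimeter_energy s.
  rewrite (_ : _ * pi ^+ 2 = (pi * energy s) / 2); last first.
    by move: pi (gt_eqF pi0) => c c0; field; rewrite c0.
  by move=> ?; lra.
by congr Num.sqrt; move: pi (gt_eqF pi0) => c c0; field; rewrite c0 gt_eqF.
Qed.

(** Comparing deviation rates thus amounts to comparing the scale invariant ratios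
    [energy / perimeter ^ 2]. The square root is strictly monotone here since
    [perimeter_energy] makes the smaller argument nonnegative, hence the larger one
    positive. *)
Lemma deviation_rate_fan_lt s s' :
  (forall p, p \in s -> 0 <= p.1) -> (forall p, p \in s' -> 0 <= p.1) ->
  0 < perimeter s -> 0 < perimeter s' ->
  energy s * perimeter s' ^+ 2 < energy s' * perimeter s ^+ 2 ->
  deviation_rate (fan s) < deviation_rate (fan s').
Proof.
move=> s0 s'0 ws ws' lt; have pi0 := @pi_gt0 R.
have w2 t : 0 < perimeter t -> 0 < 2 * perimeter t ^+ 2.
  by move=> ?; rewrite mulr_gt0// exprn_gt0.
have h : pi * energy s / (2 * perimeter s ^+ 2) <
         pi * energy s' / (2 * perimeter s' ^+ 2).
  rewrite ltr_pdivrMr ?w2// mulrAC ltr_pdivlMr ?w2//.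
  rewrite -subr_gt0.
  rewrite (_ : _ - _ = 2 * pi *
    (energy s' * perimeter s ^+ 2 - energy s * perimeter s' ^+ 2)); last by ring.
  by rewrite mulr_gt0 ?subr_gt0// mulr_gt0.
rewrite !deviation_rate_fan// ltr_sqrt; first by rewrite ltrD2r.
rewrite subr_gt0; apply: le_lt_trans h.
by rewrite ler_pdivlMr ?w2// mul1r perimeter_energy.
Qed.

End Fan.

(** * Edges of a truncated regular triangle *)

Section Geometry.
Context {R : realType}.
Implicit Types (a b c z : R[i]) (l t r d x y w phi th : R).

Local Notation normc := ComplexField.Normc.normc.
Local Notation Re := complex.Re.
Local Notation Im := complex.Im.

(** The triple angle formula makes [cos (pi / 3)] a root of
    [4 C^3 - 3 C + 1 = (C + 1) (2 C - 1)^2], and it is positive. *)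
Lemma cos_pi3 : cos (pi / 3) = 2^-1 :> R.
Proof.
have pi0 := @pi_gt0 R.
have c0 : 0 < cos (pi / 3 : R).
  by apply: cos_gt0_pihalf; apply/andP; split; lra.
have : cos (pi / 3 + pi / 3 + pi / 3) = - 1 :> R.
  by rewrite -cospi; congr cos; field.
rewrite cosD sinD cosD; have := cos2Dsin2 (pi / 3 : R).
set C := cos _; set S := sin _ => h1 h2.
have : (C + 1) * (2 * C - 1) ^+ 2 = 0.
  have -> : (C + 1) * (2 * C - 1) ^+ 2 = 4 * C ^+ 3 - 3 * C + 1 by ring.
  have S2 : S ^+ 2 = 1 - C ^+ 2 by rewrite -h1; ring.
  have : (C * C - S * S) * C - (S * C + C * S) * S = C ^+ 3 - 3 * C * S ^+ 2.
    by ring.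
  rewrite h2 S2 => h3.
  rewrite (_ : 4 * _ - _ = C ^+ 3 - 3 * C * (1 - C ^+ 2)); last by ring.
  by rewrite -h3 addNr.
move=> /eqP; rewrite mulf_eq0 gt_eqF ?addr_gt0//= expf_eq0/= subr_eq0 => /eqP h.
by apply: (@mulfI _ 2) => //; rewrite h divff.
Qed.

Lemma sin_pi3 : sin (pi / 3) = Num.sqrt 3 / 2 :> R.
Proof.
have pi0 := @pi_gt0 R.
have s0 : 0 <= sin (pi / 3 : R).
  by apply: sin_ge0_pi; apply/andP; split; lra.
have h := sin2cos2 (pi / 3 : R).
rewrite -(ger0_norm s0) -sqrtr_sqr h cos_pi3.
rewrite (_ : 1 - _ = 3 / 2 ^+ 2); last by field.
by rewrite sqrtrM// sqrtrV// sqrtr_sqr ger0_norm.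
Qed.

Lemma sqr_sqrt3 : Num.sqrt 3 ^+ 2 = 3 :> R.
Proof. by rewrite sqr_sqrtr. Qed.

Lemma cos_2pi3 : cos (2 * pi / 3) = - 2^-1 :> R.
Proof.
rewrite (_ : 2 * pi / 3 = pi / 3 + pi / 3); last by field.
have := sqr_sqrt3; rewrite cosD cos_pi3 sin_pi3 => h; lra.
Qed.

Lemma sin_2pi3 : sin (2 * pi / 3) = Num.sqrt 3 / 2 :> R.
Proof.
rewrite (_ : 2 * pi / 3 = pi / 3 + pi / 3); last by field.
by rewrite sinD cos_pi3 sin_pi3; field.
Qed.

Lemma normc_carg z :
  normc z * cos (carg z) = Re z /\ normc z * sin (carg z) = Im z.
Proof.
case: z => x y; rewrite /carg/=; set n := Num.sqrt _.
have n2 : n ^+ 2 = x ^+ 2 + y ^+ 2 by rewrite sqr_sqrtr// addr_ge0// sqr_ge0.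
have [n0|n0] := eqVneq n 0.
  move: n2; rewrite n0 expr0n/= => /esym/eqP.
  rewrite paddr_eq0 ?sqr_ge0// !sqrf_eq0 => /andP[/eqP-> /eqP->].
  by rewrite !mul0r.
have n_gt0 : 0 < n by rewrite lt_neqAle eq_sym n0 sqrtr_ge0.
have xn : -1 <= x / n <= 1.
  rewrite -ler_norml normrM normrV ?unitfE// (gtr0_norm n_gt0).
  rewrite ler_pdivrMr// mul1r -(ger0_norm (ltW n_gt0)).
  by rewrite -ler_sqr ?nnegrE// !real_normK ?num_real// n2 lerDl sqr_ge0.
have sE : n * sin (acos (x / n)) = `|y|.
  rewrite sin_acos// -{1}(ger0_norm (ltW n_gt0)) -sqrtr_sqr.
  rewrite -sqrtrM ?sqr_ge0// -sqrtr_sqr; congr Num.sqrt.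
  have -> : n ^+ 2 * (1 - (x / n) ^+ 2) = n ^+ 2 - x ^+ 2 by field.
  by rewrite n2; ring.
case: ifPn => y0.
- by rewrite sE acosK ?in_itv//= ger0_norm//; split=> //; field.
- rewrite cosN sinN mulrN sE acosK ?in_itv//= ltr0_norm ?ltNge// opprK.
  by split=> //; field.
Qed.

Lemma normc_half_sine z w : normc z * half_sine (carg z) w =
  Num.max (Im z * cos w - Re z * sin w) 0.
Proof.
have [<- <-] := normc_carg z.
have n0 : 0 <= normc z by case: z => x y; exact: sqrtr_ge0.
rewrite /half_sine maxr_pMr// mulr0 sinB; congr Num.max; ring.
Qed.

(** Hence the shadow of an edge can be computed from any polar form of the edge
    vector: the normalization of the principal argument is irrelevant. *)
Lemma normc_half_sine_polar z r th w : 0 <= r ->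
  Re z = r * cos th -> Im z = r * sin th ->
  normc z * half_sine (carg z) w = r * half_sine th w.
Proof.
move=> r0 zr zi; rewrite normc_half_sine zr zi.
by rewrite /half_sine maxr_pMr// mulr0 sinB; congr Num.max; ring.
Qed.

(** The vector [c - a] is [b - a] turned by [pi / 3]: the equality of the side
    lengths fixes its inner product with [b - a], hence the square of its cross
    product with [b - a], and the orientation fixes the sign of the latter. *)
Lemma ccw_regular_triangle_rotation a b c : ccw_regular_triangle a b c ->
  [/\ 0 < normc (b - a),
      Re (c - a) = Re (b - a) / 2 - Num.sqrt 3 / 2 * Im (b - a) &
      Im (c - a) = Im (b - a) / 2 + Num.sqrt 3 / 2 * Re (b - a)].
Proof.
case: a => a1 a2; case: b => b1 b2; case: c => c1 c2 [/=].
have -> : c1 - b1 = (c1 - a1) - (b1 - a1) by ring.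
have -> : c2 - b2 = (c2 - a2) - (b2 - a2) by ring.
have -> : a1 - c1 = - (c1 - a1) by ring.
have -> : a2 - c2 = - (c2 - a2) by ring.
move: (b1 - a1) (b2 - a2) (c1 - a1) (c2 - a2) => x y p q.
have sq u v : 0 <= u ^+ 2 + v ^+ 2 :> R by rewrite addr_ge0 ?sqr_ge0.
move=> /eqP; rewrite eqr_sqrt// => /eqP h1.
move=> /eqP; rewrite eqr_sqrt// => /eqP h2 h3.
have s2 := sqr_sqrt3; have s0 : 0 <= Num.sqrt 3 :> R by exact: sqrtr_ge0.
move: (Num.sqrt 3 : R) s2 s0 => s s2 s0.
set N := x ^+ 2 + y ^+ 2.
have N0 : 0 < N.
  rewrite lt_neqAle sq andbT eq_sym paddr_eq0 ?sqr_ge0// !sqrf_eq0.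
  apply/negP => /andP[/eqP x0 /eqP y0]; move: h3; rewrite x0 y0.
  by rewrite oppr0 !mul0r addr0 ltxx.
have dot : x * p + y * q = N / 2 by rewrite /N; nra.
have cross : x * q - y * p = s / 2 * N.
  have cr0 : 0 <= x * q - y * p by lra.
  apply/eqP; rewrite -(eqrXn2 (n := 2))//; last first.
    by rewrite mulr_ge0 ?divr_ge0// ltW.
  have -> : (x * q - y * p) ^+ 2 = N * (p ^+ 2 + q ^+ 2) - (x * p + y * q) ^+ 2.
    by rewrite /N; ring.
  have -> : p ^+ 2 + q ^+ 2 = N by rewrite /N; nra.
  rewrite dot; apply/eqP.
  have -> : (s / 2 * N) ^+ 2 = s ^+ 2 / 4 * N ^+ 2 by field.
  by rewrite s2; field.
split.
- by rewrite sqrtr_gt0.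
- apply: (@mulfI _ N); first by rewrite gt_eqF.
  have -> : N * p = x * (x * p + y * q) - y * (x * q - y * p).
    by rewrite /N; ring.
  by rewrite dot cross; field.
- apply: (@mulfI _ N); first by rewrite gt_eqF.
  have -> : N * q = y * (x * p + y * q) + x * (x * q - y * p).
    by rewrite /N; ring.
  by rewrite dot cross; field.
Qed.

(** Polar form of the cut: for a unit side along the real axis, the vector
    [1 - l * exp (i pi / 3)] from the cut of the second side to the cut of the
    first one is [d * exp (i (phi - pi / 3))]. Measuring the direction from
    [- pi / 3], that of the parallel cut, makes the problem symmetric under
    [phi -> - phi], which corresponds to [l -> 1 / l]. *)
Lemma cut_direction l : 0 < l -> exists d phi : R,
  [/\ 0 < d, `|phi| < pi / 3, d * cos phi = (1 + l) / 2,
      d * sin phi = Num.sqrt 3 * (1 - l) / 2 & phi = 0 <-> l = 1].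
Proof.
move=> l0; have pi0 := @pi_gt0 R.
have s0 : 0 < Num.sqrt 3 :> R by rewrite sqrtr_gt0.
pose u : R := Num.sqrt 3 * (1 - l) / (1 + l).
have l1 : 0 < 1 + l by lra.
have c0 : 0 < cos (atan u).
  by rewrite cos_gt0_pihalf// atan_gtNpi2 atan_ltpi2.
have tu : sin (atan u) = u * cos (atan u).
  by rewrite -{2}(atanK u) /tan mulfVK// gt_eqF.
have tan3 : tan (pi / 3) = Num.sqrt 3 :> R.
  by rewrite /tan sin_pi3 cos_pi3; field.
have at3 : atan (Num.sqrt 3) = pi / 3 :> R.
  by rewrite -tan3 tanK// in_itv/=; apply/andP; split; lra.
exists ((1 + l) / (2 * cos (atan u))), (atan u); split.
- by rewrite divr_gt0// mulr_gt0.
- rewrite -at3 ltr_norml -atanN !lt_atan// /u.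
  + by rewrite ltr_pdivrMr//; nra.
  + by rewrite ltr_pdivlMr//; nra.
- by field; rewrite gt_eqF.
- by rewrite tu /u; field; rewrite !gt_eqF.
- split=> [u0|l_eq1]; last by rewrite /u l_eq1 subrr mulr0 mul0r atan0.
  have := atanK u; rewrite u0 tan0 => uE.
  have : u * (1 + l) = Num.sqrt 3 * (1 - l) by rewrite divfK// gt_eqF.
  rewrite -uE mul0r => /esym/eqP.
  by rewrite mulf_eq0 (gt_eqF s0)/= subr_eq0 => /eqP.
Qed.

Definition truncated_fan r th l d phi t : seq (R * R) :=
  [:: (r * (1 - t), th); (r, th + 2 * pi / 3);
      (r * (1 - l * t), th - 2 * pi / 3); (r * (t * d), th - pi / 3 + phi)].

Lemma shadow_tuple3 a b c w : shadow [tuple a; b; c] w =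
  \sum_(e <- [:: b - a; c - b; a - c]) normc e * half_sine (carg e) w.
Proof.
by rewrite /shadow !big_ord_recl big_ord0 !big_cons big_nil !(tnth_nth 0).
Qed.

Lemma shadow_tuple4 a b c z w : shadow [tuple a; b; c; z] w =
  \sum_(e <- [:: b - a; c - b; z - c; a - z]) normc e * half_sine (carg e) w.
Proof.
by rewrite /shadow !big_ord_recl big_ord0 !big_cons big_nil !(tnth_nth 0).
Qed.

Lemma regular_triangle_edges a b c (r := normc (b - a)) (th := carg (b - a)) :
  ccw_regular_triangle a b c ->
  [/\ Re (c - b) = r * cos (th + 2 * pi / 3),
      Im (c - b) = r * sin (th + 2 * pi / 3),
      Re (a - c) = r * cos (th - 2 * pi / 3) &
      Im (a - c) = r * sin (th - 2 * pi / 3)].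
Proof.
move=> /ccw_regular_triangle_rotation[_ reE imE].
have [rc rs] := normc_carg (b - a); rewrite -/r -/th in rc rs.
have -> : c - b = (c - a) - (b - a) by ring.
have -> : a - c = - (c - a) by ring.
have ReB (u v : R[i]) : Re (u - v) = Re u - Re v by exact: raddfB.
have ImB (u v : R[i]) : Im (u - v) = Im u - Im v by exact: raddfB.
have ReN (u : R[i]) : Re (- u) = - Re u by exact: raddfN.
have ImN (u : R[i]) : Im (- u) = - Im u by exact: raddfN.
rewrite (ReB (c - a)) (ImB (c - a)) ReN ImN reE imE -rc -rs.
by rewrite cosD sinD cosB sinB cos_2pi3 sin_2pi3; split; field.
Qed.

Lemma shadow_truncation a b c l d phi t : ccw_regular_triangle a b c ->
  0 < d -> d * cos phi = (1 + l) / 2 ->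
  d * sin phi = Num.sqrt 3 * (1 - l) / 2 ->
  0 <= t -> t <= 1 -> l * t <= 1 ->
  shadow (truncation a b c l t) =
  fan (truncated_fan (normc (b - a)) (carg (b - a)) l d phi t).
Proof.
move=> habc d0 d_cos d_sin t0 t1 lt1.
have [r0 reE imE] := ccw_regular_triangle_rotation habc.
have [re2 im2 re3 im3] := regular_triangle_edges habc.
have [rc rs] := normc_carg (b - a).
set r := normc (b - a) in r0 rc rs re2 im2 re3 im3 *.
set th := carg (b - a) in rc rs re2 im2 re3 im3 *.
have ReZ k z : Re (k%:C * z) = k * Re z by case: z => x y /=; ring.
have ImZ k z : Im (k%:C * z) = k * Im z by case: z => x y /=; ring.
apply/funext => w; rewrite shadow_tuple4 /fan !big_cons !big_nil/=.
have e1 : b - ((1 - t)%:C * a + t%:C * b) = (1 - t)%:C * (b - a).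
  by rewrite rmorphB rmorph1; ring.
have e3 : (1 - l * t)%:C * a + (l * t)%:C * c - c = (1 - l * t)%:C * (a - c).
  by rewrite rmorphB rmorph1; ring.
have e4 : (1 - t)%:C * a + t%:C * b - ((1 - l * t)%:C * a + (l * t)%:C * c) =
    t%:C * (b - a) - (l * t)%:C * (c - a).
  by rewrite !rmorphB !rmorph1; ring.
rewrite (@normc_half_sine_polar _ (r * (1 - t)) th); last 3 first.
- by rewrite mulr_ge0 ?subr_ge0// ltW.
- by rewrite e1 ReZ -rc; ring.
- by rewrite e1 ImZ -rs; ring.
rewrite (@normc_half_sine_polar (c - b) r (th + 2 * pi / 3)) ?(ltW r0)//.
rewrite (@normc_half_sine_polar _ (r * (1 - l * t)) (th - 2 * pi / 3));
  last 3 first.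
- by rewrite mulr_ge0 ?subr_ge0// ltW.
- by rewrite e3 ReZ re3; ring.
- by rewrite e3 ImZ im3; ring.
rewrite (@normc_half_sine_polar _ (r * (t * d)) (th - pi / 3 + phi)) //.
- by rewrite mulr_ge0 ?(ltW r0)// mulr_ge0// ltW.
- rewrite e4 raddfB/= ReZ ReZ reE -rc -rs.
  rewrite cosD cosB sinB cos_pi3 sin_pi3.
  have := sqr_sqrt3; move: (Num.sqrt 3) d_sin => s d_sin s2.
  rewrite [RHS](_ : _ = r * t * (
    (cos th * 2^-1 + sin th * (s / 2)) * (d * cos phi) -
    (sin th * 2^-1 - cos th * (s / 2)) * (d * sin phi))); last by ring.
  by rewrite d_cos d_sin; field: s2.
- rewrite e4 raddfB/= ImZ ImZ imE -rc -rs.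
  rewrite sinD cosB sinB cos_pi3 sin_pi3.
  have := sqr_sqrt3; move: (Num.sqrt 3) d_sin => s d_sin s2.
  rewrite [RHS](_ : _ = r * t * (
    (sin th * 2^-1 - cos th * (s / 2)) * (d * cos phi) +
    (cos th * 2^-1 + sin th * (s / 2)) * (d * sin phi))); last by ring.
  by rewrite d_cos d_sin; field: s2.
Qed.

(** At [t = 0] the cut degenerates to an edge of length 0, which casts no shadow.
    So the triangle belongs to the family of its truncations, and the theorem
    becomes a statement about one polynomial in [t]. *)
Lemma shadow_truncation0 a b c l :
  shadow (truncation a b c l 0) = shadow [tuple a; b; c].
Proof.
apply/funext => w; rewrite shadow_tuple3 shadow_tuple4 !big_cons !big_nil.
rewrite mulr0 subr0 rmorph0 rmorph1 !mul1r !mul0r !addr0 subrr.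
by rewrite ComplexField.Normc.normc0 mul0r addr0.
Qed.

End Geometry.

(** * The directions that maximize the inner product with the triangle *)

Section Inequality.
Context {R : realType}.
Implicit Types (x y phi : R).

Lemma cos_pi6 : cos (pi / 6) = Num.sqrt 3 / 2 :> R.
Proof.
by rewrite -sin_pi3 -cosBpihalf -cosN; congr cos; field.
Qed.

Lemma sin_pi6 : sin (pi / 6) = 2^-1 :> R.
Proof.
by rewrite -cos_pi3 -cosBpihalf -cosN; congr cos; field.
Qed.

Lemma MVT_is_derive (f df : R -> R) x y : x < y ->
  (forall u, x <= u <= y -> is_derive u 1 f (df u)) ->
  exists2 u, x < u < y & f y - f x = df u * (y - x).
Proof.
move=> xy dF; have [u||u] := @MVT _ f df x y xy.
- rewrite in_itv/= => /andP[? ?]; apply: dF; apply/andP; split; exact: ltW.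
- apply: continuous_in_subspaceT => u /[!inE]/=; rewrite in_itv/= => /dF du.
  exact/differentiable_continuous/derivable1_diffP.
- by rewrite in_itv/=; exists u.
Qed.

(** On [[0, pi / 6]] the convex function [tan] lies below its chord, whose slope
    is [(1 / sqrt 3) / (pi / 6)]. If the difference [g] of the two were not
    positive at [x], the mean value theorem on each side of [x] would give [u]
    before [v] with [g' u <= 0 <= g' v], but [g'] decreases strictly. *)
Lemma tan_below_chord_pi6 x : 0 < x < pi / 6 ->
  pi * Num.sqrt 3 / 3 * sin x < 2 * x * cos x.
Proof.
move=> /andP[x0 x6]; have pi0 := @pi_gt0 R.
set k : R := pi * Num.sqrt 3 / 3.
have k0 : 0 < k by rewrite divr_gt0// mulr_gt0// sqrtr_gt0.
have cpos y : 0 <= y <= pi / 6 -> 0 < cos y.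
  by move=> /andP[? ?]; apply: cos_gt0_pihalf; apply/andP; split; lra.
pose g y : R := 2 * y - k * tan y.
have dg y : 0 <= y <= pi / 6 -> is_derive y 1 g (2 - k * (cos y) ^- 2).
  move=> /cpos cy.
  have dt := is_derive_tan (lt0r_neq0 cy).
  have := is_derive1B (is_derive1Ml 2 (is_derive_id y 1)) (is_derive1Ml k dt).
  by move=> dG; apply: (is_derive_eq dG); ring.
have g0 : g 0 = 0 by rewrite /g tan0; ring.
have g6 : g (pi / 6) = 0.
  rewrite /g /tan sin_pi6 cos_pi6 /k.
  have : Num.sqrt 3 != 0 :> R by rewrite gt_eqF// sqrtr_gt0.
  by move: pi (Num.sqrt 3) => p s s0; field; rewrite s0.
pose dgE y : R := 2 - k * (cos y) ^- 2.
have [|u /andP[u0 ux]] := @MVT_is_derive g dgE _ _ x0.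
  by move=> y /andP[? ?]; apply: dg; apply/andP; split; lra.
rewrite g0 !subr0 /dgE => gx.
have [|v /andP[xv v6]] := @MVT_is_derive g dgE _ _ x6.
  by move=> y /andP[? ?]; apply: dg; apply/andP; split; lra.
rewrite g6 sub0r /dgE => gv.
have cx : 0 < cos x by apply: cpos; apply/andP; split; lra.
have cu : 0 < cos u by apply: cpos; apply/andP; split; lra.
have cv : 0 < cos v by apply: cpos; apply/andP; split; lra.
have cuv : (cos u) ^- 2 < (cos v) ^- 2.
  rewrite ltf_pV2 ?posrE ?exprn_gt0// ltr_pXn2r ?nnegrE ?ltW//.
  rewrite ltr_cos ?in_itv/=; first lra.
  - by apply/andP; split; lra.
  - by apply/andP; split; lra.
have gx0 : 0 < g x.
  rewrite ltNge; apply/negP => gx0.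
  have h1 : 2 - k * (cos u) ^- 2 <= 0 by rewrite -(pmulr_lle0 _ x0) -gx.
  have h2 : 0 <= 2 - k * (cos v) ^- 2.
    rewrite -(pmulr_lge0 _ (_ : 0 < pi / 6 - x)) ?subr_gt0// -gv.
    by rewrite oppr_ge0.
  have : k * (cos u) ^- 2 < k * (cos v) ^- 2 by rewrite ltr_pM2l.
  lra.
move: gx0; rewrite /g /tan subr_gt0 -(ltr_pM2r cx).
by rewrite -[k * _ * _]mulrA divfK ?gt_eqF.
Qed.

(** Twice the inner product of the shadow of the regular triangle of unit side with
    the half-sine of a direction at angle [x] of the normal to a side. The shadow
    of the regular triangle has period [pi / 3], so the range [|x| <= pi / 6],
    with the direction of a side at both ends, covers all directions. *)
Definition cross_energy x : R :=
  2 * x * sin x + (2 + pi * Num.sqrt 3 / 3) * cos x.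

Lemma cross_energyN x : cross_energy (- x) = cross_energy x.
Proof. by rewrite /cross_energy sinN cosN; ring. Qed.

Lemma cross_energy_pi6 : cross_energy (pi / 6) = Num.sqrt 3 + 2 * pi / 3.
Proof.
rewrite /cross_energy sin_pi6 cos_pi6.
have := @sqr_sqrt3 R; move: (Num.sqrt 3) => s s2.
by field: s2.
Qed.

(** The derivative at [x] is [2 x cos x - (pi / sqrt 3) sin x], positive on
    [(0, pi / 6)] by the chord inequality for [tan]. So the directions of the
    sides are the only maximizers. *)
Lemma cross_energy_lt x : `|x| < pi / 6 ->
  cross_energy x < cross_energy (pi / 6).
Proof.
wlog x0 : x / 0 <= x.
  move=> H; have [/H//|/ltW x0] := leP 0 x.
  by rewrite -(cross_energyN x) -normrN; apply: H; rewrite oppr_ge0.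
rewrite ger0_norm// => x6.
have dh y : is_derive y 1 cross_energy
    (2 * y * cos y - pi * Num.sqrt 3 / 3 * sin y).
  have := is_derive1D
   (is_derive1M (is_derive1Ml 2 (is_derive_id y 1)) (is_derive_sin y))
   (is_derive1Ml (2 + pi * Num.sqrt 3 / 3) (is_derive_cos y)).
  by move=> dG; apply: (is_derive_eq dG); ring.
have [u /andP[xu u6] hE] := MVT_is_derive x6 (fun y _ => dh y).
rewrite -subr_gt0 hE mulr_gt0 ?subr_gt0//; apply: tan_below_chord_pi6.
by rewrite (le_lt_trans x0).
Qed.

Lemma sqrt3_lt2 : Num.sqrt 3 < 2 :> R.
Proof.
by rewrite -ltr_sqr ?nnegrE ?sqrtr_ge0// sqr_sqrt3 -natrX ltr_nat.
Qed.

(** The comparison of [cross_energy] at [0] and [pi / 6] reads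
    [(2 - sqrt 3) * (pi - 3) > 0]. *)
Lemma pi_gt3 : 3 < pi :> R.
Proof.
have pi0 := @pi_gt0 R.
have := @cross_energy_lt 0.
rewrite normr0 cross_energy_pi6 /cross_energy sin0 cos0.
move=> /(_ (divr_gt0 pi0 (ltr0Sn R 5))).
have := sqrt3_lt2.
move: (Num.sqrt 3 : R) (pi : R) => s p s2 h.
have : 0 < (2 - s) * (p - 3) by lra.
by rewrite pmulr_rgt0 ?subr_gt0.
Qed.

(** The left-hand side is the inner product of the half-sine of the cut with the
    shadow of the triangle, and the right-hand side is its value when the cut is
    parallel to a side. *)
Lemma corr_sum_lt phi : 0 < `|phi| < pi / 3 ->
  corr (pi / 3 - phi) + corr (pi / 3 + phi) + corr (pi - `|phi|) <
  pi / 3 + Num.sqrt 3 / 2.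
Proof.
wlog phi0 : phi / 0 <= phi.
  move=> H; have [/H//|/ltW x0] := leP 0 phi.
  rewrite -normrN => /(H (- phi)); rewrite oppr_ge0 => /(_ x0).
  by rewrite opprK [X in X + _]addrC.
rewrite ger0_norm// => /andP[phi_gt0 phi3].
have : cross_energy (pi / 6 - phi) < cross_energy (pi / 6).
  by apply: cross_energy_lt; rewrite ltr_norml; apply/andP; split; lra.
rewrite cross_energy_pi6.
have -> : corr (pi / 3 - phi) + corr (pi / 3 + phi) + corr (pi - phi) =
    cross_energy (pi / 6 - phi) / 2.
  rewrite /corr /cross_energy !cosB !sinB cosD sinD cospi sinpi cos_pi3 sin_pi3.
  rewrite cos_pi6 sin_pi6; have := @sqr_sqrt3 R; move: (Num.sqrt 3) => s s2.
  by field: s2.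
lra.
Qed.

End Inequality.

(** * Energy of the truncation and conclusion *)

Section Energy.
Context {R : realType}.
Implicit Types (r th l d phi t : R).

Lemma corr0 : corr 0 = pi / 2 :> R.
Proof. by rewrite /corr cos0 sin0 subr0 mulr1 addr0. Qed.

Lemma corr_pi : corr pi = 0 :> R.
Proof. by rewrite /corr sinpi subrr; field. Qed.

Lemma corr_pi3 : corr (pi / 3) = pi / 6 + Num.sqrt 3 / 4 :> R.
Proof. by rewrite /corr cos_pi3 sin_pi3; field. Qed.

Lemma corr_2pi3 : corr (2 * pi / 3) = Num.sqrt 3 / 4 - pi / 12 :> R.
Proof. by rewrite /corr cos_2pi3 sin_2pi3; field. Qed.

Lemma half_sine_dot_corr (th th' phi : R) : th = th' + phi ->
  0 <= phi <= pi -> half_sine_dot th th' = corr phi.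
Proof. by move=> -> ?; rewrite half_sine_dotE. Qed.

Lemma perimeter_truncated_fan r th l d phi t :
  perimeter (truncated_fan r th l d phi t) = r * (3 - (1 + l - d) * t).
Proof. by rewrite /perimeter !big_cons big_nil/=; ring. Qed.

(** All angles between edges are evaluated by [half_sine_dotE], which wants them in
    [[0, pi]]. From the side [c - b] to the cut the angle is [pi - phi] or
    [pi + phi] according to the sense of rotation, and the one that lies in
    [[0, pi]] is [pi - `|phi|]. *)
Lemma energy_truncated_fan r th l d phi t : `|phi| <= pi / 3 ->
  energy (truncated_fan r th l d phi t) = r ^+ 2 *
  (corr 0 * ((1 - t) ^+ 2 + 1 + (1 - l * t) ^+ 2 + (t * d) ^+ 2)
   + 2 * corr (2 * pi / 3) *
     ((1 - t) + (1 - t) * (1 - l * t) + (1 - l * t))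
   + 2 * (t * d) * ((1 - t) * corr (pi / 3 - phi)
     + (1 - l * t) * corr (pi / 3 + phi) + corr (pi - `|phi|))).
Proof.
move=> phi3; have pi0 := @pi_gt0 R.
have [phi1 phi2] : - (pi / 3) <= phi /\ phi <= pi / 3.
  by apply/andP; rewrite -ler_norml.
set th2 := th + 2 * pi / 3; set th3 := th - 2 * pi / 3.
set th4 := th - pi / 3 + phi.
have dd (a : R) : half_sine_dot a a = corr 0.
  by apply: half_sine_dot_corr; [rewrite addr0|rewrite lexx ltW].
have d21 : half_sine_dot th2 th = corr (2 * pi / 3).
  by apply: half_sine_dot_corr => //; apply/andP; split; lra.
have d13 : half_sine_dot th th3 = corr (2 * pi / 3).
  by apply: half_sine_dot_corr; [rewrite /th3; ring|apply/andP; split; lra].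
have d32 : half_sine_dot th3 th2 = corr (2 * pi / 3).
  rewrite -half_sine_dotD2pi; apply: half_sine_dot_corr.
    by rewrite /th3 /th2; field.
  by apply/andP; split; lra.
have d14 : half_sine_dot th th4 = corr (pi / 3 - phi).
  by apply: half_sine_dot_corr; [rewrite /th4; ring|apply/andP; split; lra].
have d43 : half_sine_dot th4 th3 = corr (pi / 3 + phi).
  apply: half_sine_dot_corr; first by rewrite /th3 /th4; field.
  by apply/andP; split; lra.
have d24 : half_sine_dot th2 th4 = corr (pi - `|phi|).
  have [p0|p0] := leP 0 phi.
    rewrite ger0_norm//; apply: half_sine_dot_corr.
      by rewrite /th2 /th4; field.
    by apply/andP; split; lra.
  rewrite ltr0_norm// half_sine_dotC -half_sine_dotD2pi.
  apply: half_sine_dot_corr; last by apply/andP; split; lra.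
  by rewrite /th2 /th4; field.
rewrite /energy /truncated_fan !big_cons !big_nil/= -/th2 -/th3 -/th4.
rewrite !dd (half_sine_dotC th th2) d21 (half_sine_dotC th3 th) d13.
rewrite (half_sine_dotC th2 th3) d32 (half_sine_dotC th4 th) d14.
rewrite (half_sine_dotC th3 th4) d43 (half_sine_dotC th4 th2) d24.
by move: (corr _) (corr _) (corr _) (corr _) (corr _) => *; ring.
Qed.

End Energy.

Theorem theorem8 (R : realType) (a b c : R[i]) (l : R)
    (habc : ccw_regular_triangle a b c) (hl : 0 < l) :
  (l = 1 ->
     \forall t \near 0^'+,
       deviation_rate (shadow [tuple a; b; c])
         < deviation_rate (shadow (truncation a b c l t))) /\
  (l <> 1 ->
     \forall t \near 0^'+,
       deviation_rate (shadow (truncation a b c l t))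
         < deviation_rate (shadow [tuple a; b; c])).
Proof.
have [d [phi [d0 phi3 dc ds phi1]]] := cut_direction hl.
have [r0 _ _] := ccw_regular_triangle_rotation habc.
rewrite -(shadow_truncation0 a b c l).
set r := ComplexField.Normc.normc (b - a) in r0 *.
set th := carg (b - a).
pose V t := truncated_fan r th l d phi t.
have VE t : 0 <= t -> t < 1 -> t < l^-1 ->
    shadow (truncation a b c l t) = fan (V t).
  move=> t0 t1 tl; apply: shadow_truncation => //; first exact: ltW.
  by rewrite mulrC ltW// -ltr_pdivlMr// div1r.
have V_ge0 t : 0 <= t -> t < 1 -> t < l^-1 -> forall p, p \in V t -> 0 <= p.1.
  move=> t0 t1 tl; have tl1 : l * t <= 1.
    by rewrite mulrC ltW// -ltr_pdivlMr// div1r.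
  move=> p; rewrite !inE => /or4P[] /eqP->/=.
  - by rewrite mulr_ge0 ?subr_ge0// ltW.
  - exact: ltW.
  - by rewrite mulr_ge0 ?subr_ge0// ltW.
  - by rewrite mulr_ge0 ?(ltW r0)// mulr_ge0// ltW.
have pi0 := @pi_gt0 R.
have W_gt0 t : 0 <= t -> t < 1 -> t < l^-1 -> 0 < perimeter (V t).
  move=> t0 t1 tl; rewrite perimeter_truncated_fan mulr_gt0//.
  have : l * t < 1 by rewrite mulrC -ltr_pdivlMr// div1r.
  by have := mulr_ge0 (ltW d0) t0; nra.
have l'0 : 0 < l^-1 by rewrite invr_gt0.
(* [S] and [q] are the inner products of the shadow of the unit triangle with the
   half-sines of the cut and of a side. *)
pose q : R := pi / 3 + Num.sqrt 3 / 2.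
pose S := corr (pi / 3 - phi) + corr (pi / 3 + phi) + corr (pi - `|phi|).
pose e := 9 * (corr 0 * (1 + l ^+ 2 + d ^+ 2) + 2 * corr (2 * pi / 3) * l
  - 2 * d * (corr (pi / 3 - phi) + l * corr (pi / 3 + phi)))
  - 3 * q * (1 + l - d) ^+ 2.
(* To first order, a change of the edge lengths changes the energy by twice the
   inner products of the edges concerned with the shadow of the triangle. If all
   of these were [q], as they are for the sides, energy and squared perimeter
   would change in the same proportion; only the new edge deviates, by [S - q]. *)
have key t : energy (V t) * perimeter (V 0) ^+ 2 - energy (V 0) * perimeter (V t) ^+ 2
    = r ^+ 4 * t * (18 * d * (S - q) + t * e).
  rewrite !perimeter_truncated_fan !energy_truncated_fan ?(ltW phi3)//.
  have qE : q = corr 0 + 2 * corr (2 * pi / 3).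
    by rewrite corr0 corr_2pi3 /q; field.
  rewrite /S /e qE.
  by move: (corr _) (corr _) (corr _) (corr _) (corr _) => *; ring.
have r4 : 0 < r ^+ 4 by rewrite exprn_gt0.
split=> l1.
- have p0 : phi = 0 by exact/phi1.
  have d1 : d = 1 by move: dc; rewrite p0 cos0 l1; lra.
  near=> t.
  have t0 : 0 < t by near: t; exact: nbhs_right_gt.
  have t1 : t < 1 by near: t; exact: nbhs_right_lt.
  have tl : t < l^-1 by near: t; exact: nbhs_right_lt.
  rewrite !VE ?(ltW t0)//; apply: deviation_rate_fan_lt.
  + exact: V_ge0.
  + exact: V_ge0 (ltW t0) t1 tl.
  + exact: W_gt0.
  + exact: W_gt0 (ltW t0) t1 tl.
  rewrite -subr_gt0 key /S /e p0 d1 l1 normr0 !subr0 !addr0.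
  rewrite corr0 corr_pi corr_pi3 corr_2pi3 /q.
  rewrite mulr_gt0//; first by rewrite mulr_gt0.
  (* Here [S = q] and [e = 5 * pi - 6 * sqrt 3]. *)
  rewrite [ltRHS](_ : _ = t * (5 * pi - 6 * Num.sqrt 3)); last by field.
  rewrite mulr_gt0// subr_gt0.
  have := @pi_gt3 R; have := @sqrt3_lt2 R; lra.
- have Sq : S - q < 0.
    rewrite subr_lt0; apply: corr_sum_lt; rewrite phi3 andbT normr_gt0.
    by apply/eqP => /phi1.
  have h : 18 * d * (S - q) < 0 by rewrite pmulr_rlt0// mulr_gt0.
  have e0 : 0 < `|e| + 1 by rewrite ltr_wpDl.
  near=> t.
  have t0 : 0 < t by near: t; exact: nbhs_right_gt.
  have t1 : t < 1 by near: t; exact: nbhs_right_lt.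
  have tl : t < l^-1 by near: t; exact: nbhs_right_lt.
  have te : t < - (18 * d * (S - q)) / (`|e| + 1).
    by near: t; apply: nbhs_right_lt; rewrite divr_gt0// oppr_gt0.
  rewrite !VE ?(ltW t0)//; apply: deviation_rate_fan_lt.
  + exact: V_ge0 (ltW t0) t1 tl.
  + exact: V_ge0.
  + exact: W_gt0 (ltW t0) t1 tl.
  + exact: W_gt0.
  rewrite -subr_lt0 key pmulr_rlt0; last by rewrite mulr_gt0.
  move: te; rewrite ltr_pdivlMr// mulrDr mulr1 => te.
  have := ler_norm e; rewrite -(ler_pM2l t0); lra.
Unshelve. all: end_near.
Qed.
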